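(* Let $P$ and $Q$ be probability measures on $\mathcal X$, and let $k:\mathcal X\times\mathcal X\to\mathbb R$ be a symmetric positive semi-definite kernel. Suppose that $$k(x,x)-2k(x,y)+k(y,y)\le c^2\,d(x,y)^{2\alpha},\qquad x,y\in\mathcal X,$$ for some $c>0$ and $\alpha\ge1/2$. Then $$\mathrm{MMD}_k(P,Q)\le c\,W_{2\alpha}(P,Q)^{\alpha}.$$
   Context: $\mathcal X\subset\mathbb R^m$ and $d:\mathcal X\times\mathcal X\to[0,\infty)$ is a cost or distance function. The Wasserstein distance of order $r\ge1$ is $$W_r(P,Q):=\Big(\inf_\pi\iint_{\mathcal X\times\mathcal X}d(x,y)^r\,\pi(\mathrm dx,\mathrm dy)\Big)^{1/r},$$ the infimum being over probability measures $\pi$ on $\mathcal X\times\mathcal X$ with marginals $P$ and $Q$. $\mathcal H_k$ is the reproducing kernel Hilbert space with kernel $k$. The mean embedding of a measure $\mu$ is $\mu_k(\cdot):=\int_{\mathcal X}k(x,\cdot)\,\mu(\mathrm dx)\in\mathcal H_k$ (understood to exist for the measures considered), and $\mathrm{MMD}_k(\mu,\nu):=\|\mu_k-\nu_k\|_{\mathcal H_k}$; equivalently, $\mathrm{MMD}_k(\mu,\nu)=\sup\{\int\varphi\,\mathrm d\mu-\int\varphi\,\mathrm d\nu:\ \varphi\in\mathcal H_k,\ \|\varphi\|_{\mathcal H_k}\le1\}$. *)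

(* Defs.v *)
From HB Require Import structures.
From mathcomp Require Import all_boot all_order all_algebra.
From mathcomp Require Import all_classical all_reals all_analysis.

Set Implicit Arguments.
Unset Strict Implicit.
Unset Printing Implicit Defensive.

Import Order.TTheory GRing.Theory Num.Theory.
Import numFieldNormedType.Exports.

Local Open Scope classical_set_scope.
Local Open Scope ring_scope.

(** The subset [X] of R^m as a measurable space: the subtype [set_type X] with
    the Borel sigma-algebra of its subspace topology.  The nonemptiness proof
    [X0] is needed because a [measurableType] is pointed; it excludes nothing,
    as the empty set carries no probability measure. *)
Definition borel_subset (R : realType) (m : nat) (X : set 'rV[R]_m)
  (X0 : X !=set0) : Type := set_type X.

Section borel_subset_instances.
Context (R : realType) (m : nat) (X : set 'rV[R]_m) (X0 : X !=set0).
Local Notation T := (borel_subset X0).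

Let borel_sets : set (set T) := <<s (@open (set_type X)) >>.

Let borel_set0 : borel_sets set0.
Proof. exact: sigma_algebra0. Qed.

Let borel_setC (A : set T) : borel_sets A -> borel_sets (~` A).
Proof. by move=> mA; rewrite -setTD; exact: sigma_algebraCD. Qed.

Let borel_bigcup (F : (set T)^nat) :
  (forall i, borel_sets (F i)) -> borel_sets (\bigcup_i F i).
Proof. exact: sigma_algebra_bigcup. Qed.

Let borel_point : T := exist _ (sval (cid X0)) (mem_set (svalP (cid X0))).

HB.instance Definition _ := Choice.copy T (set_type X).
HB.instance Definition _ := isPointed.Build T borel_point.
HB.instance Definition _ :=
  @isMeasurable.Build (sigma_display (@open (set_type X))) T
    borel_sets borel_set0 borel_setC borel_bigcup.

End borel_subset_instances.

Section wasserstein.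
Local Open Scope ereal_scope.
Context (disp : measure_display) (T : measurableType disp) (R : realType).

Definition couplings (P Q : probability T R) :
    set (probability (T * T)%type R) :=
  [set pi | (forall A, measurable A -> pushforward pi fst A = P A) /\
            (forall A, measurable A -> pushforward pi snd A = Q A)].

(** Valued in [\bar R]: the infimum of the transport costs may be [+oo]. *)
Definition wasserstein (r : R) (d : T -> T -> R) (P Q : probability T R)
    : \bar R :=
  (ereal_inf [set \int[pi]_z ((d z.1 z.2) `^ r)%:E | pi in couplings P Q])
    `^ r^-1.

End wasserstein.

Section rkhs.
Context (R : realType) (T : Type).

Definition psd_kernel (k : T -> T -> R) : Prop :=
  (forall x y, k x y = k y x) /\
  (forall (n : nat) (a : 'I_n -> R) (x : 'I_n -> T),
     0 <= \sum_(i < n) \sum_(j < n) a i * a j * k (x i) (x j)).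

Definition dot_norm (dot : (T -> R) -> (T -> R) -> R) (f : T -> R) : R :=
  Num.sqrt (dot f f).

(** A Hilbert space of functions on [T] with reproducing kernel [k]; by the
    Moore-Aronszajn theorem there is exactly one for each symmetric positive
    semi-definite [k].  The values of [rkhs_dot] outside the carrier are
    irrelevant. *)
Record rkhs (k : T -> T -> R) := Rkhs {
  rkhs_set : set (T -> R) ;
  rkhs_dot : (T -> R) -> (T -> R) -> R ;
  rkhs0 : rkhs_set (fun=> 0) ;
  rkhs_lin : forall (a : R) f g, rkhs_set f -> rkhs_set g ->
    rkhs_set (fun x => a * f x + g x) ;
  rkhs_dotC : forall f g, rkhs_set f -> rkhs_set g ->
    rkhs_dot f g = rkhs_dot g f ;
  rkhs_dot_lin : forall (a : R) f g h,
    rkhs_set f -> rkhs_set g -> rkhs_set h ->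
    rkhs_dot (fun x => a * f x + g x) h = a * rkhs_dot f h + rkhs_dot g h ;
  rkhs_dot_ge0 : forall f, rkhs_set f -> 0 <= rkhs_dot f f ;
  rkhs_dot_eq0 : forall f, rkhs_set f -> rkhs_dot f f = 0 -> f = (fun=> 0) ;
  rkhs_complete : forall u : nat -> (T -> R), (forall n, rkhs_set (u n)) ->
    (forall e : R, 0 < e ->
       \forall p & q \near \oo, dot_norm rkhs_dot (u p \- u q) < e) ->
    exists2 f, rkhs_set f &
      dot_norm rkhs_dot (u n \- f) @[n --> \oo] --> (0 : R) ;
  rkhs_kernel : forall x, rkhs_set (k x) ;
  rkhs_reproducing : forall f x, rkhs_set f -> rkhs_dot f (k x) = f x
}.

Definition rkhs_norm (k : T -> T -> R) (H : rkhs k) (f : T -> R) : R :=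
  dot_norm (rkhs_dot H) f.

End rkhs.

Section mmd.
Context (disp : measure_display) (T : measurableType disp) (R : realType).
Context (k : T -> T -> R).

Definition mean_embedding (mu : probability T R) : T -> R :=
  fun y => \int[mu]_x k x y.

(** The function [y |-> int k(x, y) mu(dx)] is well defined and belongs to the
    RKHS.  This is implied by the existence of the integral as a Bochner or
    Pettis integral in the RKHS, in which case the two coincide. *)
Definition has_mean_embedding (H : rkhs k) (mu : probability T R) : Prop :=
  (forall y, mu.-integrable [set: T] (fun x => (k x y)%:E)) /\
  rkhs_set H (mean_embedding mu).

Definition MMD (H : rkhs k) (mu nu : probability T R) : R :=
  rkhs_norm H (mean_embedding mu \- mean_embedding nu).

End mmd.

(* Main.v *)
(** The functions f of the RKHS H that are P- and Q-integrable with
    <mu_P, f> = int f dP and <mu_Q, f> = int f dQ form a linear subspace S that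
    contains every k(x, .), hence S is dense in H.  For f in S and a coupling pi,
    expanding 0 <= |f - (k_x - k_y)|^2 gives the pointwise bound
      2 (f x - f y) - |f|^2 <= |k_x - k_y|^2 <= c^2 d(x, y)^(2 alpha),
    and integrating it against pi, with g = mu_P - mu_Q,
      |g|^2 - |g - f|^2 = 2 <g, f> - |f|^2 <= c^2 int d^(2 alpha) dpi.
    Letting f tend to g and minimizing over pi concludes.  Working in S avoids
    assuming that all of H is integrable. *)
Require Import Defs.
From mathcomp Require Import all_boot all_order all_algebra.
From mathcomp Require Import all_classical all_reals all_analysis.
From mathcomp Require Import measurable_realfun ring lra.

Set Implicit Arguments.
Unset Strict Implicit.
Unset Printing Implicit Defensive.

Local Open Scope classical_set_scope.
Local Open Scope ring_scope.

Import Order.TTheory GRing.Theory Num.Theory.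
Import numFieldNormedType.Exports.

(** * Hilbert space geometry of the RKHS *)

Section rkhs_theory.
Context (R : realType) (T : Type) (k : T -> T -> R) (H : rkhs k).
Implicit Types (f g h : T -> R) (a b : R).
Local Notation mem := (rkhs_set H).
Local Notation "''[' f , g ]" := (rkhs_dot H f g) (format "''[' f ,  g ]").

Lemma rkhs_dot0l h : mem h -> '[fun=> 0, h] = 0.
Proof.
move=> Hh; have H0 := rkhs0 H.
have := rkhs_dot_lin 1 H0 H0 Hh.
have -> : (fun=> 1 * 0 + 0) = (fun=> 0) :> (T -> R).
  by apply/funext => x; rewrite mulr0 addr0.
by lra.
Qed.

Lemma rkhs_comb a b f g : mem f -> mem g -> mem (fun x => a * f x + b * g x).
Proof.
move=> Hf Hg.
have -> : (fun x => a * f x + b * g x) = (fun x => a * f x + (b * g x + 0)).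
  by apply/funext => x; rewrite addr0.
by apply: rkhs_lin => //; apply: (rkhs_lin b Hg (rkhs0 H)).
Qed.

Lemma rkhs_dot_combl a b f g h : mem f -> mem g -> mem h ->
  '[fun x => a * f x + b * g x, h] = a * '[f, h] + b * '[g, h].
Proof.
move=> Hf Hg Hh.
have -> : (fun x => a * f x + b * g x) = (fun x => a * f x + (b * g x + 0)).
  by apply/funext => x; rewrite addr0.
have HG := rkhs_lin b Hg (rkhs0 H).
rewrite (rkhs_dot_lin a Hf HG Hh) (rkhs_dot_lin b Hg (rkhs0 H) Hh).
by rewrite rkhs_dot0l// addr0.
Qed.

Lemma rkhs_dot_comb2 a b f g : mem f -> mem g ->
  '[fun x => a * f x + b * g x, fun x => a * f x + b * g x] =
  a ^+ 2 * '[f, f] + 2 * (a * b * '[f, g]) + b ^+ 2 * '[g, g].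
Proof.
move=> Hf Hg; have Hfg := rkhs_comb a b Hf Hg.
rewrite rkhs_dot_combl// (rkhs_dotC Hf Hfg) (rkhs_dotC Hg Hfg).
by rewrite !rkhs_dot_combl// (rkhs_dotC Hg Hf); ring.
Qed.

Lemma subf_comb f g : f \- g = (fun x => 1 * f x + (-1) * g x).
Proof. by apply/funext => x /=; rewrite mul1r mulN1r. Qed.

Lemma rkhsB f g : mem f -> mem g -> mem (f \- g).
Proof. by move=> Hf Hg; rewrite subf_comb; exact: rkhs_comb. Qed.

Lemma rkhs_dotBl f g h : mem f -> mem g -> mem h ->
  '[f \- g, h] = '[f, h] - '[g, h].
Proof. by move=> *; rewrite subf_comb rkhs_dot_combl// mul1r mulN1r. Qed.

Lemma rkhs_dotB2 f g : mem f -> mem g ->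
  '[f \- g, f \- g] = '[f, f] - 2 * '[f, g] + '[g, g].
Proof. by move=> *; rewrite subf_comb rkhs_dot_comb2//; ring. Qed.

Lemma rkhs_dot_kernel x y : '[k x, k y] = k x y.
Proof. by rewrite rkhs_reproducing//; exact: rkhs_kernel. Qed.

(** Cauchy-Schwarz against [k x]: the polynomial [|f + t k_x|^2] in [t] is nonnegative. *)
Lemma rkhs_eval_sqr_le f x : mem f -> f x ^+ 2 <= '[f, f] * k x x.
Proof.
move=> Hf; have Hk := rkhs_kernel H x.
have P t : 0 <= '[f, f] + 2 * t * f x + t ^+ 2 * k x x.
  have := rkhs_dot_ge0 (rkhs_comb 1 t Hf Hk).
  by rewrite rkhs_dot_comb2// rkhs_dot_kernel rkhs_reproducing//; lra.
have kx0 : 0 <= k x x by rewrite -rkhs_dot_kernel; exact: rkhs_dot_ge0.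
have [kx|kx] := eqVneq (k x x) 0.
  have [->|fx] := eqVneq (f x) 0; first by rewrite kx mulr0 expr0n.
  (* When [k x x = 0] the polynomial is affine in [t], and this [t] would give it the value -1. *)
  have := P (- ('[f, f] + 1) / (2 * f x)).
  rewrite kx mulr0 addr0.
  have -> : 2 * (- ('[f, f] + 1) / (2 * f x)) * f x = - ('[f, f] + 1) by field.
  by lra.
have {}kx0 : 0 < k x x by rewrite lt_def kx.
(* The minimizer of the quadratic. *)
have := P (- f x / k x x).
rewrite -(pmulr_rge0 _ kx0).
have -> : k x x * ('[f, f] + 2 * (- f x / k x x) * f x
    + (- f x / k x x) ^+ 2 * k x x) = '[f, f] * k x x - f x ^+ 2 by field.
by rewrite subr_ge0.
Qed.

(** A sequence in [S] minimizing the distance to [g] is Cauchy, hence converges to some [h]. By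
    minimality [g - h] is orthogonal to every [k x], so it vanishes pointwise by the reproducing
    property. *)
Lemma rkhs_kernel_dense (S : set (T -> R)) g (e : R) :
  S `<=` mem -> S (fun=> 0) ->
  (forall a b f1 f2, S f1 -> S f2 -> S (fun x => a * f1 x + b * f2 x)) ->
  (forall x, S (k x)) -> mem g -> 0 < e ->
  exists2 f, S f & '[g \- f, g \- f] < e.
Proof.
move=> SH S0 Slin Sk Hg e0.
pose E := [set '[g \- f, g \- f] | f in S].
have E_lb : has_lbound E.
  by exists 0 => _ [f Sf <-]; apply/rkhs_dot_ge0/rkhsB => //; exact: SH.
have E_inf : has_inf E.
  by split => //; exists '[g \- cst 0, g \- cst 0]; exists (cst 0).
pose delta := inf E.
have delta_le f : S f -> delta <= '[g \- f, g \- f].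
  by move=> Sf; apply: ge_inf => //; exists f.
have /choice[u uP] : forall n : nat, exists f, S f /\
    '[g \- f, g \- f] < delta + n.+1%:R^-1.
  move=> n; have n0 : 0 < n.+1%:R^-1 :> R by rewrite invr_gt0.
  by have [_ [f Sf <-] Ef] := inf_adherent n0 E_inf; exists f.
have Su n : S (u n) by case: (uP n).
have Hu n : mem (u n) by exact: SH.
have Hgu n : mem (g \- u n) by exact: rkhsB.
have u_lt n : '[g \- u n, g \- u n] < delta + n.+1%:R^-1 by case: (uP n).
(* parallelogram law, the midpoint of [u p] and [u q] lying in S *)
have u_cauchy p q :
    '[u p \- u q, u p \- u q] <= 2 * (p.+1%:R^-1 + q.+1%:R^-1).
  have := delta_le _ (Slin (1 / 2) (1 / 2) _ _ (Su p) (Su q)).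
  have -> : g \- (fun x => 1 / 2 * u p x + 1 / 2 * u q x) =
      (fun x => 1 / 2 * (g \- u p) x + 1 / 2 * (g \- u q) x).
    by apply/funext => x /=; lra.
  have -> : u p \- u q = (g \- u q) \- (g \- u p).
    by apply/funext => x /=; ring.
  rewrite rkhs_dot_comb2// (rkhs_dotB2 (Hgu q) (Hgu p)).
  rewrite (rkhs_dotC (Hgu q) (Hgu p)).
  have := u_lt p; have := u_lt q.
  by move: p.+1%:R^-1 q.+1%:R^-1 => ip iq; lra.
have norm_lt f r : mem f -> 0 < r -> '[f, f] < r ^+ 2 ->
    dot_norm (rkhs_dot H) f < r.
  move=> Hf r0 fr; rewrite /dot_norm -[ltRHS]gtr0_norm// -sqrtr_sqr.
  by rewrite ltr_sqrt// exprn_gt0.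
have [h Hh uh] : exists2 h, mem h &
    dot_norm (rkhs_dot H) (u n \- h) @[n --> \oo] --> (0 : R).
  apply: rkhs_complete => // r r0.
  (* Two inverses below [r ^+ 2 / 4] bring the bound of [u_cauchy] below [r ^+ 2]. *)
  have r4 : 0 < r ^+ 2 / 4 by rewrite divr_gt0// exprn_gt0.
  near=> p q => /=; apply: norm_lt => //; first exact: rkhsB.
  apply: le_lt_trans (u_cauchy p q) _.
  have -> : r ^+ 2 = 2 * (r ^+ 2 / 4 + r ^+ 2 / 4) by lra.
  rewrite ltr_pM2l//; apply: ltrD.
    by near: p; exact: (near_infty_natSinv_lt (PosNum r4)).
  by near: q; exact: (near_infty_natSinv_lt (PosNum r4)).
have uh_small r : 0 < r ->
    \forall n \near \oo, '[u n \- h, u n \- h] < r /\ n.+1%:R^-1 < r.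
  move=> r0.
  have s0 : 0 < Num.sqrt r by rewrite sqrtr_gt0.
  have /cvgr0_norm_lt/(_ _ s0) uhr := uh.
  near=> n; split; last first.
    by near: n; exact: (near_infty_natSinv_lt (PosNum r0)).
  rewrite -ltr_sqrt//; apply: le_lt_trans (ler_norm _) _.
  by near: n.
have gh : g = h.
  apply/funext => x; apply/eqP; rewrite -subr_eq0; apply/eqP.
  set z := g x - h x.
  have kx0 : 0 <= k x x.
    by rewrite -rkhs_dot_kernel; apply: rkhs_dot_ge0; exact: rkhs_kernel.
  (* minimality of [delta] under the perturbations [u n + t k x] *)
  have zt (t r : R) : 0 < r -> 2 * t * z <= t ^+ 2 * k x x + r.
    move=> r0.
    (* [C] is a positive majorant of [t ^+ 2 * k x x], safe to divide by. The minimum below leaves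
       [r / 2] for the excess [1 / (n + 1)] over [delta] and [r / 2] for the error made by replacing
       [h x] with [u n x]. *)
    pose C := t ^+ 2 * k x x + 2.
    have C0 : 0 < C by rewrite ltr_wpDl// mulr_ge0// sqr_ge0.
    have s0 : 0 < r / 2 by rewrite divr_gt0.
    have m0 : 0 < Num.min (r / 2) ((r / 2) ^+ 2 / C / 4).
      by rewrite lt_min s0/= !divr_gt0// exprn_gt0.
    have [n _ /(_ n (leqnn n))[un nr]] := uh_small _ m0.
    move: un nr; rewrite !lt_min => /andP[_ un] /andP[nr _].
    have := delta_le _ (Slin 1 t _ _ (Su n) (Sk x)).
    have -> : g \- (fun y => 1 * u n y + t * k x y) =
        (fun y => 1 * (g \- u n) y + (- t) * k x y).
      by apply/funext => y /=; ring.
    rewrite rkhs_dot_comb2//; last exact: rkhs_kernel.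
    rewrite rkhs_dot_kernel rkhs_reproducing//=.
    have := u_lt n.
    suff : `|2 * t * (u n x - h x)| <= r / 2.
      move: nr; rewrite ler_norml /z.
      by move: n.+1%:R^-1 => iN ? /andP[]; lra.
    rewrite -ler_sqr ?nnegrE//; last exact: ltW.
    rewrite real_normK ?num_real// exprMn.
    have := rkhs_eval_sqr_le x (rkhsB (Hu n) Hh) => /= ev.
    have t2 : 0 <= (2 * t) ^+ 2 by exact: sqr_ge0.
    apply: le_trans (ler_wpM2l t2 ev) _.
    have -> : (2 * t) ^+ 2 * ('[u n \- h, u n \- h] * k x x) =
      '[u n \- h, u n \- h] * (4 * (C - 2)) by rewrite /C; ring.
    have un0 : 0 <= '[u n \- h, u n \- h] by apply/rkhs_dot_ge0/rkhsB.
    apply: (@le_trans _ _ ('[u n \- h, u n \- h] * (4 * C))).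
      by rewrite ler_wpM2l//; lra.
    by move/ltW: un; rewrite !ler_pdivlMr//; lra.
  have zt0 t : 2 * t * z <= t ^+ 2 * k x x.
    by apply/ler_addgt0Pr => r r0; exact: zt.
  have K0 : 0 < k x x + 1 by lra.
  (* The added 1 keeps the denominator positive. With [w = z^2 / (k x x + 1)], this [t] gives
     [2 w <= w * (k x x / (k x x + 1)) <= w], so [z = 0]. *)
  have := zt0 (z / (k x x + 1)).
  have -> : 2 * (z / (k x x + 1)) * z = 2 * (z ^+ 2 / (k x x + 1)).
    by rewrite expr2; ring.
  have -> : (z / (k x x + 1)) ^+ 2 * k x x =
      (z ^+ 2 / (k x x + 1)) * (k x x / (k x x + 1)) by field; lra.
  have w0 : 0 <= z ^+ 2 / (k x x + 1) by rewrite divr_ge0 ?sqr_ge0// ltW.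
  have v1 : k x x / (k x x + 1) <= 1 by rewrite ler_pdivrMr//; lra.
  have := ler_wpM2l w0 v1; rewrite mulr1 => A B.
  have : z ^+ 2 / (k x x + 1) <= 0 by lra.
  rewrite ler_pdivrMr// mul0r => z2.
  by apply/eqP; rewrite -sqrf_eq0 eq_le z2 sqr_ge0.
have [n _ /(_ n (leqnn n))[un _]] := uh_small _ e0.
exists (u n) => //; rewrite gh.
by move: un; rewrite !rkhs_dotB2// (rkhs_dotC (Hu n) Hh); lra.
Unshelve. all: by end_near. Qed.

End rkhs_theory.

(** * Monotonicity and change of variables for integrals *)

(* [integral] is a supremum over simple functions on the positive and negative
   parts, so monotonicity does not need measurability. *)
Lemma le_integral_pointwise (disp : measure_display)
    (T : measurableType disp) (R : realType)
    (mu : {measure set T -> \bar R}) (f g : T -> \bar R) :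
  (forall x, f x <= g x)%E -> (\int[mu]_x f x <= \int[mu]_x g x)%E.
Proof.
move=> fg; rewrite (integralE _ _ f) (integralE _ _ g).
have mono (u v : T -> \bar R) :
    (forall x, 0 <= u x)%E -> (forall x, u x <= v x)%E ->
    (\int[mu]_x u x <= \int[mu]_x v x)%E.
  move=> u0 uv; have v0 x : (0 <= v x)%E by exact: le_trans (u0 x) (uv x).
  rewrite !ge0_integralTE//; apply: ereal_sup_le => _ [h hu <-].
  by exists h => // x; exact: le_trans (hu x) (uv x).
apply: leeB; apply: mono => x.
- exact: funepos_ge0.
- by rewrite !funeposE ge_max !le_max fg lexx orbT.
- exact: funeneg_ge0.
- by rewrite !funenegE ge_max !le_max leeN2 fg lexx orbT.
Qed.

Lemma integrable_image (d1 d2 : measure_display) (X : measurableType d1)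
    (Y : measurableType d2) (R : realType) (mu : {measure set X -> \bar R})
    (nu : {measure set Y -> \bar R}) (phi : X -> Y) (f : Y -> \bar R) :
  measurable_fun [set: X] phi ->
  (forall A, measurable A -> pushforward mu phi A = nu A) ->
  nu.-integrable [set: Y] f ->
  mu.-integrable [set: X] (f \o phi) /\
  (\int[mu]_x f (phi x) = \int[nu]_y f y)%E.
Proof.
move=> mphi munu fi; have [mf finf] := integrableP _ _ _ fi.
(* The two measures agree on measurable sets, which is all the integral sees. *)
have nuE (h : Y -> \bar R) :
    (\int[nu]_y h y = \int[pushforward mu phi]_y h y)%E.
  by apply: eq_measure_integral => A mA _; exact/esym/munu.
have ifphi : mu.-integrable [set: X] (f \o phi).
  apply/integrableP; split; first exact: (measurable_comp measurableT _ mf mphi).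
  rewrite -[X in (integral _ X _ < _)%E](preimage_setT phi).
  rewrite -(@ge0_integral_pushforward _ _ _ _ _ _ mphi mu setT (abse \o f))//.
  - by rewrite -nuE.
  - exact: measurableT_comp.
  - by move=> y _; exact: abse_ge0.
split=> //.
by rewrite nuE integral_pushforward// preimage_setT.
Qed.

(** * Pairing with mean embeddings, and the transport bound *)

Section mean_embedding_theory.
Context (disp : measure_display) (T : measurableType disp) (R : realType).
Context (k : T -> T -> R) (H : rkhs k).

(* As the mean embedding is only a pointwise integral, that pairing with it
   integrates [f] is not automatic on all of [H]. *)
Definition pettis (mu : probability T R) : set (T -> R) :=
  [set f | [/\ rkhs_set H f, mu.-integrable [set: T] (EFin \o f) &
    rkhs_dot H (mean_embedding k mu) f = \int[mu]_x f x]].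

Lemma pettis0 mu : has_mean_embedding H mu -> pettis mu (fun=> 0).
Proof.
move=> [_ Hm]; have H0 := rkhs0 H; split=> //.
  exact: integrable0.
by rewrite rkhs_dotC// rkhs_dot0l// Rintegral_cst// mul0r.
Qed.

Lemma pettis_comb mu a b f g : has_mean_embedding H mu ->
  pettis mu f -> pettis mu g -> pettis mu (fun x => a * f x + b * g x).
Proof.
move=> [_ Hm] [Hf If Ef] [Hg Ig Eg].
have Iaf : mu.-integrable [set: T] (EFin \o (fun x => a * f x)).
  exact: (integrableZl measurableT a If).
have Ibg : mu.-integrable [set: T] (EFin \o (fun x => b * g x)).
  exact: (integrableZl measurableT b Ig).
have Hfg := rkhs_comb a b Hf Hg.
split=> //; first exact: (integrableD measurableT Iaf Ibg).
rewrite rkhs_dotC// rkhs_dot_combl// (rkhs_dotC Hf Hm) (rkhs_dotC Hg Hm).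
by rewrite RintegralD// !RintegralZl// Ef Eg.
Qed.

(** Pairing with [k x] evaluates the mean embedding at [x], which is the integral of [k ^~ x];
    symmetry of [k] identifies this function with [k x]. *)
Lemma pettis_kernel mu x : psd_kernel k -> has_mean_embedding H mu ->
  pettis mu (k x).
Proof.
move=> [kC _] [Ik Hm].
have -> : k x = k ^~ x by apply/funext => y; rewrite kC.
split; [|exact: Ik|].
  have -> : k ^~ x = k x by apply/funext => y; rewrite kC.
  exact: rkhs_kernel.
have {1}-> : k ^~ x = k x by apply/funext => y; rewrite kC.
by rewrite rkhs_reproducing.
Qed.

Lemma coupling_Rintegral (P Q : probability T R)
    (pi : probability (T * T)%type R) f :
  couplings P Q pi ->
  P.-integrable [set: T] (EFin \o f) -> Q.-integrable [set: T] (EFin \o f) ->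
  pi.-integrable [set: T * T] (fun z => (f z.1 - f z.2)%:E) /\
  \int[pi]_z (f z.1 - f z.2) = \int[P]_x f x - \int[Q]_x f x.
Proof.
move=> [piP piQ] fP fQ.
have [i1 e1] := integrable_image measurable_fst piP fP.
have [i2 e2] := integrable_image measurable_snd piQ fQ.
split; first exact: (integrableB measurableT i1 i2).
by rewrite RintegralB//; congr (fine _ - fine _).
Qed.

(** Dividing by [c ^+ 2] isolates the transport cost, so that the infimum over couplings can be
    taken directly. *)
Lemma MMD_sqr_le_cost (P Q : probability T R)
    (pi : probability (T * T)%type R) (D : T -> T -> R) (c : R) :
  psd_kernel k -> has_mean_embedding H P -> has_mean_embedding H Q ->
  couplings P Q pi -> 0 < c ->
  (forall x y, k x x - 2 * k x y + k y y <= c ^+ 2 * D x y) ->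
  ((MMD H P Q ^+ 2 / c ^+ 2)%:E <= \int[pi]_z (D z.1 z.2)%:E)%E.
Proof.
move=> kpsd HP HQ pic c0 kD.
have [_ HmP] := HP; have [_ HmQ] := HQ.
set g := mean_embedding k P \- mean_embedding k Q.
have Hg : rkhs_set H g by exact: rkhsB.
have -> : MMD H P Q ^+ 2 = rkhs_dot H g g.
  by rewrite sqr_sqrtr//; exact: rkhs_dot_ge0.
have c20 : 0 < c ^+ 2 by rewrite exprn_gt0.
(* The slack [e] pays for replacing [g] by some [f] with [|g - f|^2 < e * c ^+ 2]. *)
apply/lee_addgt0Pr => e e0; rewrite addeC -leeBlDl// -EFinB.
have ec0 : 0 < e * c ^+ 2 by rewrite mulr_gt0.
have [|||//|f [[Hf fP EP] [_ fQ EQ]] fe] :=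
  @rkhs_kernel_dense _ _ _ H (pettis P `&` pettis Q) g _ _ _ _ _ Hg ec0.
- by move=> f [[]].
- by split; exact: pettis0.
- by move=> a b f1 f2 [? ?] [? ?]; split; exact: pettis_comb.
- by move=> x; split; exact: pettis_kernel.
have [ipi Epi] := coupling_Rintegral pic fP fQ.
pose n := rkhs_dot H f f.
(* An integrable minorant of the cost, whose integral is [(2 <g, f> - |f|^2) / c^2]. *)
pose psi (z : T * T) := (2 / c ^+ 2) * (f z.1 - f z.2) - n / c ^+ 2.
apply: (@le_trans _ _ (\int[pi]_z (psi z)%:E)%E); last first.
  apply: le_integral_pointwise => -[x y] /=; rewrite lee_fin /psi /=.
  rewrite mulrAC -mulrBl ler_pdivrMr// [leRHS]mulrC.
  apply: le_trans (kD x y).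
  have Hx := rkhs_kernel H x; have Hy := rkhs_kernel H y.
  have := rkhs_dot_ge0 (rkhsB Hf (rkhsB Hx Hy)).
  rewrite rkhs_dotB2//; last exact: rkhsB.
  rewrite rkhs_dotB2// (rkhs_dotC Hf) ?rkhs_dotBl//; last exact: rkhsB.
  rewrite (rkhs_dotC Hx Hf) (rkhs_dotC Hy Hf) !rkhs_dot_kernel.
  by rewrite !rkhs_reproducing// -/n; lra.
have i2 : pi.-integrable [set: T * T]
    (EFin \o (fun z => (2 / c ^+ 2) * (f z.1 - f z.2))).
  exact: (integrableZl measurableT _ ipi).
have icst : pi.-integrable [set: T * T] (EFin \o cst (n / c ^+ 2)).
  exact: finite_measure_integrable_cst.
have ipsi : pi.-integrable [set: T * T] (EFin \o psi).
  exact: (integrableB measurableT i2 icst).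
have Rpsi : \int[pi]_z psi z = (2 / c ^+ 2) * rkhs_dot H g f - n / c ^+ 2.
  rewrite RintegralB// Rintegral_cst// RintegralZl//.
  congr (_ * _ - _).
    by apply: etrans Epi _; rewrite -EP -EQ -rkhs_dotBl.
  by rewrite [X in fine X]probability_setT mulr1.
rewrite -[leRHS]fineK; last exact: integrable_fin_num ipsi.
rewrite lee_fin -[leRHS]/(\int[pi]_z psi z) Rpsi.
rewrite mulrAC -mulrBl ler_pdivlMr// mulrBl divfK ?gt_eqF//.
by move: fe; rewrite rkhs_dotB2// -/n; lra.
Qed.

Lemma MMD_le_wasserstein (P Q : probability T R) (d : T -> T -> R)
    (c alpha : R) :
  psd_kernel k -> has_mean_embedding H P -> has_mean_embedding H Q ->
  0 < c -> 0 < alpha ->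
  (forall x y, k x x - 2 * k x y + k y y <= c ^+ 2 * d x y `^ (2 * alpha)) ->
  ((MMD H P Q)%:E <= c%:E * wasserstein (2 * alpha) d P Q `^ alpha)%E.
Proof.
move=> kpsd HP HQ c0 a0 kd.
(* The exponents combine to [(2 * alpha)^-1 * alpha = 2^-1], a square root matching the squared
   bound on the MMD. *)
have -> : (wasserstein (2 * alpha) d P Q `^ alpha = (ereal_inf
    [set \int[pi]_z (d z.1 z.2 `^ (2 * alpha))%:E | pi in couplings P Q])
    `^ (2^-1))%E.
  rewrite /wasserstein -poweRrM; congr (_ `^ _)%E.
  by field; rewrite gt_eqF.
set I := ereal_inf _.
have MI : ((MMD H P Q ^+ 2 / c ^+ 2)%:E <= I)%E.
  apply: le_ereal_inf_tmp => _ [pi pic <-].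
  exact: (MMD_sqr_le_cost kpsd HP HQ pic c0 kd).
have M0 : 0 <= MMD H P Q by exact: sqrtr_ge0.
(* The value [-oo] contradicts [MI]; at [+oo] the right-hand side is infinite, as [c] is
   positive. *)
case: I MI => [w||] //.
- rewrite lee_fin -expr_div_n => Mw.
  have w0 : 0 <= w by exact: le_trans (sqr_ge0 _) Mw.
  rewrite poweR_EFin -EFinM lee_fin powR12_sqrt// mulrC -ler_pdivrMr//.
  rewrite -[leLHS]ger0_norm; last by rewrite divr_ge0// ltW.
  by rewrite -sqrtr_sqr ler_sqrt.
- by rewrite poweRyr ?gt_eqF// gt0_muley ?leey// lte_fin.
Qed.

End mean_embedding_theory.

Theorem proposition2p18 (R : realType) (m : nat) (X : set 'rV[R]_m)
  (X0 : X !=set0)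
  (d : borel_subset X0 -> borel_subset X0 -> R)
  (d_ge0 : forall x y, 0 <= d x y)
  (P Q : probability (borel_subset X0) R)
  (k : borel_subset X0 -> borel_subset X0 -> R)
  (k_psd : psd_kernel k)
  (H : rkhs k)
  (HP : has_mean_embedding H P) (HQ : has_mean_embedding H Q)
  (c alpha : R) (c_gt0 : 0 < c) (alpha_ge : 1 / 2 <= alpha)
  (k_le_d : forall x y,
     k x x - 2 * k x y + k y y <= c ^+ 2 * d x y `^ (2 * alpha)) :
  ((MMD H P Q)%:E <= c%:E * wasserstein (2 * alpha) d P Q `^ alpha)%E.
Proof. by apply: MMD_le_wasserstein => //; lra. Qed.
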